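(* Let $A$ be a $C^*$-algebra, $H$ a Hilbert $A$-module, and let $P,Q\in\mathcal{L}(H)$ be two projections. If both $\overline{\mathcal{R}(I-Q+P)}$ and $\overline{\mathcal{R}(2I-P-Q)}$ are orthogonally complemented in $H$, then $\overline{\mathcal{R}\big(QP(I-Q)\big)}$ is also orthogonally complemented in $H$ and $$P_{\overline{\mathcal{R}(QP(I-Q))}}=Q-P_{\mathcal{R}(Q)\cap\mathcal{N}(P)}-P_{\mathcal{R}(Q)\cap\mathcal{R}(P)}.$$
   Context: $\mathcal{L}(H)$ is the $C^*$-algebra of adjointable operators on the Hilbert $A$-module $H$; a projection is $P\in\mathcal{L}(H)$ with $P=P^2=P^*$; $\mathcal{R}$ and $\mathcal{N}$ denote range and null space. A closed submodule $M\subseteq H$ is orthogonally complemented in $H$ if $H=M+M^\perp$, where $M^\perp=\{x\in H:\langle x,y\rangle=0\ \forall y\in M\}$; then $P_M$ denotes the projection in $\mathcal{L}(H)$ with range $M$. Under the hypotheses, $\mathcal{R}(Q)\cap\mathcal{N}(P)=\overline{\mathcal{R}(I-Q+P)}^\perp$ and $\mathcal{R}(Q)\cap\mathcal{R}(P)=\overline{\mathcal{R}(2I-P-Q)}^\perp$ are orthogonally complemented, so the projections on the right-hand side are meaningful. *)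

(* Defs.v *)
From HB Require Import structures.
From mathcomp Require Import all_boot all_order all_algebra.
From mathcomp Require Import complex.
From mathcomp Require Import all_classical all_reals all_analysis.
Import Order.TTheory GRing.Theory Num.Theory.
Import numFieldNormedType.Exports.

Set Implicit Arguments.
Unset Strict Implicit.
Unset Printing Implicit Defensive.

Local Open Scope classical_set_scope.
Local Open Scope complex_scope.
Local Open Scope ring_scope.

(* C*-algebras are not assumed unital, so the product is part of the mixin
   rather than inherited from the (unital) ring structures. Norms take their
   values in the nonnegative reals of R[i]. *)
HB.mixin Record isCStarAlgebra (R : realType) A
    & CompleteNormedModule R[i] A := {
  amul : A -> A -> A ;
  astar : A -> A ;
  amulA : forall a b c, amul a (amul b c) = amul (amul a b) c ;
  amulDl : forall a b c, amul (a + b) c = amul a c + amul b c ;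
  amulDr : forall a b c, amul a (b + c) = amul a b + amul a c ;
  amulZl : forall (z : R[i]) a b, amul (z *: a) b = z *: amul a b ;
  amulZr : forall (z : R[i]) a b, amul a (z *: b) = z *: amul a b ;
  ler_norm_amul : forall a b, `|amul a b| <= `|a| * `|b| ;
  astarK : forall a, astar (astar a) = a ;
  astarD : forall a b, astar (a + b) = astar a + astar b ;
  astarZ : forall (z : R[i]) a, astar (z *: a) = Num.conj z *: astar a ;
  astarM : forall a b, astar (amul a b) = amul (astar b) (astar a) ;
  cstar_norm : forall a, `|amul (astar a) a| = `|a| ^+ 2
}.

#[short(type="cstarAlgType")]
HB.structure Definition CStarAlgebra (R : realType) :=
  { A of isCStarAlgebra R A & CompleteNormedModule R[i] A }.

Section Positivity.
Variables (R : realType) (A : cstarAlgType R).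
Implicit Types (a : A) (u v : A * R[i]).

(* The pair (a, z) stands for a + z1 in the unitization of A. *)
Definition unitization_mul u v : A * R[i] :=
  (amul u.1 v.1 + v.2 *: u.1 + u.2 *: v.1, u.2 * v.2).

Definition unitization_unit u : Prop :=
  exists v, unitization_mul u v = (0, 1) /\ unitization_mul v u = (0, 1).

(* Computed in the unitization; when A itself has a unit this differs from the
   spectrum relative to A at most by the point 0, irrelevant to positivity. *)
Definition spectrum a : set R[i] :=
  [set z | ~ unitization_unit (a, - z)].

Definition apositive a : Prop :=
  astar a = a /\ (forall z, spectrum a z -> 0 <= z).

End Positivity.

(* Right modules; the inner product is linear in its second variable. The
   ambient complete norm is tied to the inner product by inner_norm. *)
HB.mixin Record isHilbertModule (R : realType) (A : cstarAlgType R) H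
    & CompleteNormedModule R[i] H := {
  ract : H -> A -> H ;
  inner : H -> H -> A ;
  ractA : forall x a b, ract (ract x a) b = ract x (amul a b) ;
  ractDl : forall x y a, ract (x + y) a = ract x a + ract y a ;
  ractDr : forall x a b, ract x (a + b) = ract x a + ract x b ;
  ractZl : forall (z : R[i]) x a, ract (z *: x) a = z *: ract x a ;
  ractZr : forall (z : R[i]) x a, ract x (z *: a) = z *: ract x a ;
  innerDr : forall x y y', inner x (y + y') = inner x y + inner x y' ;
  innerZr : forall (z : R[i]) x y, inner x (z *: y) = z *: inner x y ;
  inner_ract : forall x y a, inner x (ract y a) = amul (inner x y) a ;
  inner_star : forall x y, astar (inner x y) = inner y x ;
  inner_ge0 : forall x, apositive (inner x x) ;
  inner_eq0 : forall x, inner x x = 0 -> x = 0 ;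
  inner_norm : forall x, `|x| ^+ 2 = `|inner x x|
}.

#[short(type="hilbertModType")]
HB.structure Definition HilbertModule (R : realType) (A : cstarAlgType R) :=
  { H of isHilbertModule R A H & CompleteNormedModule R[i] H }.

Section Operators.
Variables (R : realType) (A : cstarAlgType R) (H : hilbertModType A).
Implicit Types (T S P : H -> H) (M N : set H).

Definition adjoint_of T S : Prop :=
  forall x y : H, inner (T x) y = inner x (S y) :> A.

(* Membership in L(H); the existence of an adjoint forces T to be A-linear and
   bounded. *)
Definition adjointable T : Prop := exists S, adjoint_of T S.

Definition is_projection P : Prop :=
  [/\ adjointable P, P \o P = P & adjoint_of P P].

Definition null_space T : set H := [set x | T x = 0].

Definition orthogonal_compl M : set H :=
  [set x | forall y, M y -> inner x y = 0 :> A].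

Definition closed_submodule M : Prop :=
  [/\ closed M, M 0,
      forall x y, M x -> M y -> M (x + y),
      forall (z : R[i]) x, M x -> M (z *: x) &
      forall x (a : A), M x -> M (ract x a)].

Definition ortho_complemented M : Prop :=
  closed_submodule M /\
  forall x, exists y z, [/\ M y, orthogonal_compl M z & x = y + z].

Definition is_projection_onto M P : Prop := is_projection P /\ range P = M.

(* P_M, a junk value when M is not orthogonally complemented. *)
Definition ortho_proj M : H -> H := xget (fun=> 0) (is_projection_onto M).

Lemma innerDl (x x' y : H) : inner (x + x') y = inner x y + inner x' y :> A.
Proof.
by rewrite -(inner_star y) innerDr astarD !inner_star.
Qed.

Lemma inner0r (x : H) : inner x 0 = 0 :> A.
Proof. by have := innerZr (s := H) 0 x 0; rewrite !scale0r. Qed.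

Lemma inner0l (x : H) : inner 0 x = 0 :> A.
Proof.
apply: (addIr (inner (0 : H) x)); rewrite -innerDl addr0 add0r //.
Qed.

Lemma innerNl (x y : H) : inner (- x) y = - inner x y :> A.
Proof. by apply/eqP; rewrite -addr_eq0 -innerDl addNr inner0l. Qed.

Lemma inner_inj (x x' : H) :
  (forall y, inner x y = inner x' y :> A) -> x = x'.
Proof.
move=> h; apply/eqP; rewrite -subr_eq0; apply/eqP; apply: (inner_eq0 (s := H)).
by rewrite innerDl innerNl h subrr.
Qed.

Lemma is_projection_onto_inj M P P' :
  is_projection_onto M P -> is_projection_onto M P' -> P = P'.
Proof.
move=> [[_ PP aP] rP] [[_ PP' aP'] rP'].
have fixM T : T \o T = T -> range T = M -> forall y, M y -> T y = y.
  by move=> TT <- _ [y _ <-]; rewrite -[LHS]/((T \o T) y) TT.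
apply/funext => x; apply: inner_inj => w.
have MP : M (P x) by rewrite -rP; exists x.
have MP' : M (P' w) by rewrite -rP'; exists w.
by rewrite -(fixM _ PP' rP' _ MP) aP' aP (fixM _ PP rP _ MP') -aP'.
Qed.

Lemma ortho_projP M :
  ortho_complemented M -> is_projection_onto M (ortho_proj M).
Proof.
move=> [[_ M0 MD MZ _] dec]; apply: xgetPex.
have /choice[P hP] : forall x, exists y, M y /\ orthogonal_compl M (x - y).
  move=> x; have [y [z [My Mz ->]]] := dec x.
  by exists y; split => //; rewrite addrC addKr.
have orthoC y z : M y -> orthogonal_compl M z -> inner y z = 0 :> A.
  by move=> My Mz; rewrite -inner_star Mz// -(inner0r 0) inner_star.
have aP : adjoint_of P P.
  move=> x y; have [Mx ox] := hP x; have [My oy] := hP y.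
  rewrite -[in LHS](subrK (P y) y) innerDr (orthoC _ _ Mx oy) add0r.
  by rewrite -[in RHS](subrK (P x) x) innerDl ox// add0r.
have fixP x : M x -> P x = x.
  move=> Mx; have [MP oP] := hP x; apply/esym/eqP; rewrite -subr_eq0; apply/eqP.
  apply: (inner_eq0 (s := H)); apply: (oP); apply: MD => //.
  by rewrite -scaleN1r; exact: MZ.
exists P; split; first split => //.
- by exists P.
- by apply/funext => x /=; apply: fixP; case: (hP x).
- apply/seteqP; split => [_ [x _ <-]|x Mx]; first by case: (hP x).
  by exists x => //; exact: fixP.
Qed.

End Operators.

(* Main.v *)
(* Put [E] and [F] for the projections onto [N(I - Q + P)], which is
   [R(Q) /\ N(P)], and onto [N(2I - P - Q)], which is [R(Q) /\ R(P)]. By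
   hypothesis [x - E x] and [x - F x] lie in the closures of [R(I - Q + P)] and
   [R(2I - P - Q)]. The operator [G = Q - E - F] is a projection fixing
   [R(Q P (I - Q))] pointwise. Conversely, [G x = (Q - E) (x - F x)] is
   approximated by values of [(Q - E) Q (I - P)], hence of
   [(Q - E) Q (I - P) Q = Q (I - P) Q (I - E)], hence of [Q (I - P) Q P], hence of
   [Q (I - P) Q P Q = Q P (I - Q) P Q]. The second and the last of these steps
   use that [R(Q P)] lies in the closure of [R(Q P Q)] for any two projections. *)
From HB Require Import structures.
Require Import Defs.
From mathcomp Require Import all_boot all_order all_algebra.
From mathcomp Require Import complex ring.
From mathcomp Require Import all_classical all_reals all_analysis.
Import Order.TTheory GRing.Theory Num.Theory.
Import numFieldNormedType.Exports.
Local Open Scope classical_set_scope.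
Local Open Scope ring_scope.

(** * Continuity and closures of ranges *)

Lemma closure_range_ind {U V : topologicalType} {I : Type} (f : I -> U)
    (g : U -> V) (C : set V) : continuous g -> closed C ->
  (forall w, C (g (f w))) -> forall y, closure (range f) y -> C (g y).
Proof.
move=> cg cC Cgf y; suff: closure (range f) `<=` g @^-1` C by apply.
rewrite closureE; apply: smallest_sub; last by move=> _ [w _ <-]; exact: Cgf.
by move/continuous_closedP: cg; apply.
Qed.

Lemma additive_bounded_continuous {K : numFieldType} {V W : normedModType K}
    (f : {additive V -> W}) (k : K) : 0 <= k ->
  (forall x, `|f x| <= k * `|x|) -> continuous f.
Proof.
move=> k0 fk x; apply/cvgrPdist_le => e e0.
(* [k] may be 0, while the radius [e / (k + 1)] needs a positive divisor. *)
have k1 : 0 < k + 1 by rewrite ltr_wpDl.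
near=> y; rewrite -raddfB; apply: (le_trans (fk _)).
apply: (@le_trans _ _ ((k + 1) * `|x - y|)).
  by apply: ler_wpM2r => //; rewrite lerDl.
rewrite mulrC -ler_pdivlMr//; near: y.
by apply: cvgr_dist_le; rewrite ?divr_gt0.
Unshelve. all: by end_near. Qed.

(** * Inner products and adjoints *)

Section Adjoints.
Context {R : realType} {A : cstarAlgType R} {H : hilbertModType A}.
Implicit Types (x y z : H) (S T P Q : H -> H) (M : set H).

Lemma innerNr x y : inner x (- y) = - inner x y :> A.
Proof. by rewrite -scaleN1r innerZr scaleN1r. Qed.

Lemma innerBr x y z : inner x (y - z) = inner x y - inner x z :> A.
Proof. by rewrite innerDr innerNr. Qed.

Lemma innerBl x y z : inner (x - y) z = inner x z - inner y z :> A.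
Proof. by rewrite innerDl innerNl. Qed.

Lemma innerZl (c : R[i]) x y : inner (c *: x) y = Num.conj c *: inner x y :> A.
Proof. by rewrite -(inner_star y) innerZr astarZ inner_star. Qed.

Lemma innerC0 x y : inner x y = 0 :> A -> inner y x = 0 :> A.
Proof. by move=> xy; rewrite -inner_star xy -(inner0r (H := H) 0) inner_star. Qed.

Lemma adjoint_ofC S T : adjoint_of T S -> adjoint_of S T.
Proof. by move=> TS x y; rewrite -inner_star -TS inner_star. Qed.

Lemma adjoint_of_linear S T : adjoint_of T S -> linear T.
Proof.
move=> TS c x y; apply: inner_inj => z.
by rewrite TS !innerDl !innerZl !TS.
Qed.

(** The real part leaves [2(<x,y> + <y,x>)], the ['i] part [2(<x,y> - <y,x>)]; its sign reflects
    linearity in the second variable. *)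
Lemma inner_polarization x y :
  4 *: inner x y = inner (x + y) (x + y) - inner (x - y) (x - y)
    - 'i *: (inner (x + 'i *: y) (x + 'i *: y)
             - inner (x - 'i *: y) (x - 'i *: y)) :> A.
Proof.
have parD (u v : H) : inner (u + v) (u + v) - inner (u - v) (u - v)
    = (inner u v + inner v u) *+ 2 :> A.
  have -> : inner (u + v) (u + v)
      = (inner u u + inner v v) + (inner u v + inner v u) :> A.
    by rewrite innerDl !innerDr (addrC (inner v u)) addrACA.
  have -> : inner (u - v) (u - v)
      = (inner u u + inner v v) - (inner u v + inner v u) :> A.
    by rewrite innerBl !innerBr opprB [in RHS]opprD addrACA.
  by rewrite opprB addrC addrA subrK mulr2n.
rewrite !parD innerZr innerZl conjCi -scalerMnr scalerDr !scalerA.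
rewrite mulrN -expr2 sqrCi opprK scaleN1r scale1r mulrnDl mulrnDl mulNrn.
rewrite opprD opprK addrACA subrr addr0 -mulr2n -mulrnA.
by rewrite scaler_nat.
Qed.

(* The constant 4 of the polarization identity (instead of 1) suffices, and
   spares the order theory of [A] needed for the Cauchy-Schwarz inequality. *)
Lemma norm_inner x y : `|inner x y : A| <= 4 * `|x| * `|y|.
Proof.
have unit_bound (u v : H) : `|u| = 1 -> `|v| = 1 -> `|inner u v : A| <= 4.
  move=> u1 v1; rewrite -(@ler_pM2l _ 4)//.
  (* The boolean picks the sign, so [q] bounds all four terms of the polarization by [(1 + 1)^2],
     giving 16 in total. *)
  have q (w : H) : `|w| = 1 -> forall b : bool,
     `|inner (u + (-1) ^+ b *: w) (u + (-1) ^+ b *: w) : A| <= 4.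
    move=> w1 b; rewrite -inner_norm.
    have -> : (4 : R[i]) = 2 ^+ 2 by rewrite -natrX.
    rewrite lerXn2r ?nnegrE//.
    apply: le_trans (ler_normD _ _) _; rewrite u1 normrZ normrX normrN1 expr1n.
    by rewrite w1 mulr1.
  have iv1 : `|'i *: v| = 1 by rewrite normrZ normCi v1 mulr1.
  have := q _ v1 false; have := q _ v1 true.
  have := q _ iv1 false; have := q _ iv1 true.
  rewrite !expr1 !expr0 !scale1r !scaleN1r => q1 q2 q3 q4.
  have -> : 4 * `|inner u v : A| = `|4 *: inner u v : A|.
    by rewrite normrZ ger0_norm.
  rewrite inner_polarization.
  have -> : (4 * 4 : R[i]) = (4 + 4) + (4 + 4) by rewrite -!natrD -natrM.
  apply: le_trans (ler_normB _ _) _; apply: lerD.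
    by apply: le_trans (ler_normB _ _) _; apply: lerD.
  rewrite normrZ normCi mul1r.
  by apply: le_trans (ler_normB _ _) _; apply: lerD.
have [->|x0] := eqVneq x 0; first by rewrite inner0l !normr0 mulr0 mul0r.
have [->|y0] := eqVneq y 0; first by rewrite inner0r !normr0 mulr0.
have nx : `|x| != 0 by rewrite normr_eq0.
have ny : `|y| != 0 by rewrite normr_eq0.
have unit_norm (z : H) : `|z| != 0 -> `| `|z|^-1 *: z| = 1.
  by move=> z0; rewrite normrZ normrV ?unitfE// normr_id mulVf.
have := unit_bound _ _ (unit_norm x nx) (unit_norm y ny).
rewrite innerZl innerZr scalerA normrZ normrM norm_conjC !normrV ?unitfE//.
rewrite !normr_id -invfM mulrC ler_pdivrMr ?mulrA//.
by rewrite mulr_gt0 ?normr_gt0.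
Qed.

Lemma continuous_innerr z : continuous (inner z : H -> A).
Proof.
pose f : {additive H -> A} := HB.pack (inner z : H -> A)
  (GRing.isZmodMorphism.Build H A (inner z) (innerBr z)).
exact: (@additive_bounded_continuous _ _ _ f (4 * `|z|) _ (norm_inner z)).
Qed.

Lemma orthogonal_compl_closure_range {I : Type} (f : I -> H) z :
  (forall w, inner z (f w) = 0 :> A) -> orthogonal_compl (closure (range f)) z.
Proof.
move=> zf; apply: (closure_range_ind f (inner z) [set 0]) => //.
  exact: continuous_innerr.
exact/accessible_closed_set1/hausdorff_accessible/norm_hausdorff.
Qed.

End Adjoints.

(** * Projections: linearity, contractivity, ranges *)

Section Projections.
Context {R : realType} {A : cstarAlgType R} {H : hilbertModType A}.
Implicit Types (x y z : H) (P Q : {linear H -> H}) (M : set H).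

Lemma is_projection_linear (S : H -> H) :
  is_projection S -> exists P : {linear H -> H}, S = P.
Proof.
case=> _ _ /adjoint_of_linear lS.
pose P : {linear H -> H} := HB.pack S (GRing.isLinear.Build R[i] H H *:%R S lS).
by exists P.
Qed.

Lemma projK P : is_projection P -> forall x, P (P x) = P x.
Proof. by case=> _ PP _ x; rewrite -[LHS]/((P \o P) x) PP. Qed.

Lemma proj_adj P : is_projection P -> adjoint_of P P.
Proof. by case. Qed.

Lemma is_projectionP P :
  (forall x, P (P x) = P x) -> adjoint_of P P -> is_projection P.
Proof. by move=> PP Pa; split=> //; [exists P|exact/funext]. Qed.

Lemma is_projection_compl P : is_projection P -> is_projection (idfun \- P).
Proof.
move=> hP; apply: (@is_projectionP (idfun \- P)) => [x|x y] /=.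
  by rewrite linearB projK// subrr subr0.
by rewrite innerBl innerBr proj_adj.
Qed.

(* [2 P - 1] preserves inner products, hence norms; [P] is its average with the
   identity. *)
Lemma norm_proj P x : is_projection P -> `|P x| <= `|x|.
Proof.
move=> hP; have iso : `|P x + P x - x| = `|x|.
  apply/eqP; rewrite -(eqrXn2 (n := 2))// !inner_norm; apply/eqP; congr `|_|.
  rewrite !(innerDl, innerBr, innerDr, innerNl) -!(proj_adj P hP _ x) projK//.
  by rewrite !addrK opprB addrC addrNK.
rewrite -(@ler_pM2l _ 2)// -[X in X * `|P x|](@ger0_norm _ 2)// -normrZ.
rewrite scaler_nat mulr2n -(subrK x (P x + P x)).
by apply: le_trans (ler_normD _ _) _; rewrite iso mulr2n mulrDl mul1r.
Qed.

Lemma continuous_proj P : is_projection P -> continuous P.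
Proof.
move=> hP; apply: (@additive_bounded_continuous _ _ _ P 1) => // x.
by rewrite mul1r norm_proj.
Qed.

Lemma range_projP P x : is_projection P -> range P x <-> P x = x.
Proof.
by move=> hP; split=> [[y _ <-]|<-]; [rewrite projK|exists x].
Qed.

End Projections.

(** * Cesaro means of iterates *)

Section Cesaro.
Context {K : numFieldType} {V : normedModType K}.
Implicit Types (T S : {linear V -> V}) (x : V) (n : nat).

(** The sum runs over [0 <= k <= n], so the divisor [n + 1] never vanishes. *)
Definition cesaro (T : V -> V) n x : V :=
  n.+1%:R^-1 *: \sum_(0 <= k < n.+1) iter k T x.

Lemma norm_iter T k x : (forall y, `|T y| <= `|y|) -> `|iter k T x| <= `|x|.
Proof.
by move=> cT; elim: k => //= k; apply: le_trans; exact: cT.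
Qed.

Lemma norm_cesaro T n x : (forall y, `|T y| <= `|y|) -> `|cesaro T n x| <= `|x|.
Proof.
move=> cT; rewrite normrZ ger0_norm ?invr_ge0// ler_pdivrMl ?ltr0n//.
apply: le_trans (ler_norm_sum _ _ _) _.
rewrite mulr_natl -[n.+1 in leRHS]subn0 -sumr_const_nat.
by apply: ler_sum => k _; exact: norm_iter.
Qed.

(** Telescoping. For a contraction the right side is at most [2 |x| / (n + 1)], so the means are
    almost fixed by [T]. *)
Lemma cesaro_fixB T n x :
  cesaro T n x - T (cesaro T n x) = n.+1%:R^-1 *: (x - iter n.+1 T x).
Proof.
rewrite linearZ linear_sum -scalerBr -sumrB; congr (_ *: _).
rewrite -[RHS]opprB.
rewrite -[X in - X](telescope_sumr (fun k => iter k T x) (leq0n n.+1)) -sumrN.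
by apply: eq_bigr => k _; rewrite opprB.
Qed.

(** [x] is the mean of [n + 1] copies of itself, and preimages under the linear [S] can be
    averaged. *)
Lemma range_subr_cesaro T S n x :
  (forall k, range S (x - iter k T x)) -> range S (x - cesaro T n x).
Proof.
move=> rS; have /choice[w hw] : forall k, exists w, S w = x - iter k T x.
  by move=> k; have [w _ <-] := rS k; exists w.
rewrite /cesaro.
exists (n.+1%:R^-1 *: \sum_(0 <= k < n.+1) w k) => //.
rewrite linearZ linear_sum.
under eq_bigr do rewrite hw.
rewrite sumrB sumr_const_nat subn0 /= scalerBr -[x *+ _]scaler_nat scalerA.
by rewrite mulVf ?pnatr_eq0// scale1r.
Qed.

End Cesaro.

(** The order on [R[i]] is partial, but [c / d] is nonnegative, hence real, and [R] is
    Archimedean. *)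
Lemma complex_archi {R : realType} (c d : R[i]) :
  0 <= c -> 0 < d -> exists n, c / n.+1%:R < d.
Proof.
move=> c0 d0; have cd : 0 <= c / d by rewrite divr_ge0// ltW.
exists (Num.truncn (complex.Re (c / d))).
rewrite ltr_pdivrMr// mulrC -ltr_pdivrMr// -(RRe_real (ger0_real cd)).
by rewrite -(rmorph_nat (real_complex R)) ltcR truncnS_gt.
Qed.

Lemma closure_normP {K : numFieldType} {V : normedModType K} (S : set V) y :
  (forall e, 0 < e -> exists2 z, S z & `|y - z| < e) -> closure S y.
Proof.
move=> h B /nbhs_ballP[e e0 eB]; have [z Sz yz] := h e e0.
by exists z; split => //; apply: eB; rewrite -ball_normE.
Qed.

(** * Compression of one projection by another *)

Section TwoProjections.
Context {R : realType} {A : cstarAlgType R} {H : hilbertModType A}.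
Implicit Types (x y z : H) (P Q : {linear H -> H}).

(* An instance of [cl (R(K)) = cl (R(K K^* ))], [K = Q P]. With
   [T = Q (1 - P) Q], the Cesaro means [r_n] of the powers of [T] satisfy
   [y - r_n y] in [R(Q P Q)] for [y = Q P x], and [r_n y = Q P r'_n x] for the
   means [r'_n] of [T' = P (1 - Q) P]. Since [|Q P r'_n x|^2] is
   [|<r'_n x, (1 - T') r'_n x>|] and [(1 - T') r'_n = (1 - T'^n) / n], it tends to [0]. *)
Lemma closure_range_compression P Q x : is_projection P -> is_projection Q ->
  closure (range (Q \o P \o Q)) (Q (P x)).
Proof.
move=> hP hQ.
pose P' : {linear H -> H} := idfun \- P; pose Q' : {linear H -> H} := idfun \- Q.
have hP' : is_projection P' := is_projection_compl P hP.
have hQ' : is_projection Q' := is_projection_compl Q hQ.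
pose T : {linear H -> H} := Q \o P' \o Q.
pose T' : {linear H -> H} := P \o Q' \o P.
have cT' y : `|T' y| <= `|y|.
  apply: le_trans (norm_proj P _ hP) _; apply: le_trans (norm_proj Q' _ hQ') _.
  exact: norm_proj.
(* The intertwining [T Q P = Q P T']. Starting from [P x] keeps the iterates of [T'] in the range of
   [P]. *)
have iterT k : iter k T (Q (P x)) = Q (P (iter k T' (P x))).
  elim: k => [|k /= ->]; first by rewrite /= projK.
  by rewrite /T /T' /P' /Q' /= !linearB !projK.
have rangeT k : range (Q \o P \o Q) (Q (P x) - iter k T (Q (P x))).
  elim: k => [|k [w _ /= hw]]; first by exists 0; rewrite //= !linear0 subrr.
  have Tk : iter k T (Q (P x)) = Q (P x) - Q (P (Q w)) by rewrite hw subKr.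
  (* On the range of [Q], [1 - T] is [Q P Q]; hence [T^k y - T^(k+1) y = Q P Q T^k y] for
     [y = Q P x]. *)
  exists (w + iter k T (Q (P x))) => //.
  rewrite /= -/(iter _ _ _) Tk.
  rewrite /T /P' /= !(linearB Q, linearB P, linearD Q, linearD P) !(projK Q hQ).
  by rewrite opprB opprB [_ + (Q (P (Q w)) - _)]addrA [RHS]addrC subrK addrC.
have cesT n : cesaro T n (Q (P x)) = Q (P (cesaro T' n (P x))).
  rewrite /cesaro (linearZ_LR P) (linearZ_LR Q) (linear_sum P) (linear_sum Q).
  congr (_ *: _).
  by apply: eq_bigr => k _; rewrite iterT.
have PT' n : P (cesaro T' n (P x)) = cesaro T' n (P x).
  rewrite /cesaro linearZ linear_sum; congr (_ *: _); apply: eq_bigr.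
  by case=> [|k] _ /=; rewrite projK.
(* [8 = 4 * 2]: 4 from [norm_inner], 2 from the triangle inequality for [P x - T'^(n+1) P x]. *)
have small n : `|cesaro T n (Q (P x))| ^+ 2 <= 8 * `|x| ^+ 2 / n.+1%:R.
  rewrite cesT; set r := cesaro T' n (P x).
  have -> : `|Q (P r)| ^+ 2 = `|inner r (r - T' r) : A|.
    rewrite inner_norm (proj_adj Q hQ) projK// (proj_adj P hP).
    by rewrite /T' /= linearB !PT' opprB addrC subrK.
  apply: le_trans (norm_inner _ _) _; rewrite cesaro_fixB.
  have rx : `|r| <= `|x|.
    by apply: le_trans (norm_cesaro _ _ _ cT') _; exact: norm_proj.
  have dx : `|P x - iter n.+1 T' (P x)| <= 2 * `|x|.
    apply: le_trans (ler_normB _ _) _; rewrite mulr2n mulrDl mul1r.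
    by apply: lerD; [|apply: le_trans (norm_iter _ _ _ cT') _]; exact: norm_proj.
  have -> : 8 * `|x| ^+ 2 / n.+1%:R = 4 * `|x| * (n.+1%:R^-1 * (2 * `|x|)) :> R[i].
    by rewrite (_ : 8 = 4 * 2) -?natrM//; ring.
  apply: ler_pM; [exact: mulr_ge0|exact: normr_ge0|by apply: ler_wpM2l|].
  by rewrite normrZ ger0_norm ?invr_ge0// ler_wpM2l ?invr_ge0.
apply: closure_normP => e e0.
have [n hn] : exists n, 8 * `|x| ^+ 2 / n.+1%:R < e ^+ 2.
  by apply: complex_archi; rewrite ?exprn_gt0// mulr_ge0// exprn_ge0.
exists (Q (P x) - cesaro T n (Q (P x))).
  exact: (@range_subr_cesaro _ _ T (Q \o P \o Q)).
rewrite subKr -(@ltr_pXn2r _ 2)// ?nnegrE// ?(ltW e0)//.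
exact: le_lt_trans hn.
Qed.

End TwoProjections.

(** * Orthogonal complements and null spaces *)

Section Complements.
Context {R : realType} {A : cstarAlgType R} {H : hilbertModType A}.
Implicit Types (x y z : H) (S T : H -> H) (M : set H).

(** The null space is the orthogonal complement of the range of the adjoint, an intersection of
    kernels of the continuous maps [inner (S y)]. *)
Lemma closed_submodule_null_space T S :
  adjoint_of T S -> closed_submodule (null_space T).
Proof.
move=> TS; have nE x : null_space T x <-> forall y, inner (S y) x = 0 :> A.
  rewrite /null_space /=; split=> [Tx y|Sx].
    by rewrite (adjoint_ofC _ _ TS) Tx inner0r.
  by apply: inner_inj => y; rewrite inner0l TS innerC0.
split.
- have -> : null_space T = \bigcap_(y in setT) (inner (S y) @^-1` [set 0 : A]).
    by apply/seteqP; split=> [x /nE Sx y _|x Sx]; [exact: Sx|apply/nE => y; exact: Sx].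
  apply: closed_bigI => y _; have /continuous_closedP := continuous_innerr (S y).
  apply; exact/accessible_closed_set1/hausdorff_accessible/norm_hausdorff.
- by apply/nE => y; exact: inner0r.
- by move=> x y /nE Tx /nE Ty; apply/nE => z; rewrite innerDr Tx Ty addr0.
- by move=> c x /nE Tx; apply/nE => y; rewrite innerZr Tx scaler0.
- move=> x a /nE Tx; apply/nE => y; rewrite inner_ract Tx.
  by have := amulZl (s := A) 0 0 a; rewrite !scale0r.
Qed.

Lemma range_projE (P : {linear H -> H}) :
  is_projection P -> range P = null_space (idfun \- P).
Proof.
move=> hP; apply/seteqP; split=> x; rewrite range_projP// /null_space /=.
  by move->; rewrite subrr.
by move/eqP; rewrite subr_eq0 => /eqP.
Qed.

(** Converse of [ortho_projP], by the splitting [x = P x + (x - P x)]. *)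
Lemma ortho_complemented_proj M S :
  is_projection_onto M S -> ortho_complemented M.
Proof.
case=> /[dup] /is_projection_linear[P ->] hP <-; split.
  rewrite range_projE//.
  exact/closed_submodule_null_space/proj_adj/(is_projection_compl P hP).
move=> x; exists (P x), (x - P x); split; [by exists x| |by rewrite addrC subrK].
by move=> _ [y _ <-]; rewrite innerBl (proj_adj P hP x) projK// subrr.
Qed.

Lemma ortho_proj_unique M S : is_projection_onto M S -> ortho_proj M = S.
Proof.
move=> MS; apply: is_projection_onto_inj (MS).
exact/ortho_projP/(ortho_complemented_proj _ _ MS).
Qed.

(** For self-adjoint [T] the complement of the range is the null space, so the given splitting of
    [x] also projects it onto [null_space T], with remainder in the closure of the range. *)
Lemma ortho_complemented_null_space T : adjoint_of T T ->
  ortho_complemented (closure (range T)) ->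
  ortho_complemented (null_space T) /\
  forall x, closure (range T) (x - ortho_proj (null_space T) x).
Proof.
move=> TT [_ hT].
have orthoN y n : closure (range T) y -> null_space T n -> inner y n = 0 :> A.
  move=> Ty Tn; apply: innerC0; apply: orthogonal_compl_closure_range (Ty).
  by move=> w; rewrite -TT Tn inner0l.
have dec x : exists y z, [/\ closure (range T) y, null_space T z & x = y + z].
  have [y [z [Ty Tz xyz]]] := hT x; exists y, z; split=> //.
  apply: inner_inj => w; rewrite inner0l TT; apply: Tz.
  by apply: subset_closure; exists w.
have cN : ortho_complemented (null_space T).
  split; first exact: closed_submodule_null_space TT.
  move=> x; have [y [z [Ty Tz ->]]] := dec x.
  exists z, y; split=> //; last by rewrite addrC.
  by move=> n; exact: orthoN.
split=> // x; have [y [z [Ty Tz ->]]] := dec x.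
have [/[dup] /is_projection_linear[E EE] + rE] := ortho_projP cN.
rewrite EE => hE; rewrite EE in rE.
have -> : E (y + z) = z.
  have Ez : E z = z by apply/range_projP => //; rewrite rE.
  suff Ey : E y = 0 by rewrite linearD Ey Ez add0r.
  apply: inner_inj => w; rewrite (proj_adj E hE) inner0l orthoN//.
  by rewrite -rE; exists w.
by rewrite addrK.
Qed.

Lemma adjoint_comp_swap S T U : adjoint_of S S -> adjoint_of T T ->
  adjoint_of U U -> (forall x, S (T x) = U x) -> forall x, T (S x) = U x.
Proof.
by move=> hS hT hU ST x; apply: inner_inj => y; rewrite hT hS ST hU.
Qed.

End Complements.

(** * Null spaces as intersections *)

Section NullSpaces.
Context {R : realType} {A : cstarAlgType R} {H : hilbertModType A}.
Implicit Types P Q : {linear H -> H}.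

(** Applying [Q] to [x - Qx + Px = 0] gives [QPx = 0]; pairing [Px = Qx - x] with [Px] yields
    [<Px,Px> = -<Px,Px>], so [Px = 0]. *)
Lemma null_space_compl_add P Q : is_projection P -> is_projection Q ->
  null_space (idfun \- Q \+ P) = range Q `&` null_space P.
Proof.
move=> hP hQ; apply/seteqP; split=> x; rewrite /null_space /=; last first.
  by case=> /range_projP -> // ->; rewrite subrr addr0.
move=> h; have QP : Q (P x) = 0.
  by rewrite -[RHS](linear0 Q) -h linearD linearB projK// subrr add0r.
have Px : P x = Q x - x.
  by apply/eqP; rewrite -subr_eq0 opprB addrC h.
have P0 : P x = 0.
  have nP : inner (P x) (P x) = - inner (P x) (P x) :> A.
    rewrite {2}Px innerBr -(proj_adj Q hQ) QP inner0l sub0r.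
    by rewrite -(proj_adj P hP (P x)) projK.
  apply: (inner_eq0 (s := H)); apply: (scalerI (a := 2 : R[i])) => //.
  by rewrite scaler0 scaler_nat mulr2n {1}nP addNr.
split=> //; apply/range_projP => //.
by apply/eqP; rewrite -subr_eq0 -Px P0.
Qed.

(** Applying [P] and [Q] to [2x = Px + Qx] gives [PQx = Px] and [QPx = Qx]; hence
    [<Px - Qx, Px - Qx> = 0] and [x = Px = Qx]. *)
Lemma null_space_compl_compl P Q : is_projection P -> is_projection Q ->
  null_space (idfun *+ 2 \- P \- Q) = range Q `&` range P.
Proof.
move=> hP hQ; apply/seteqP; split=> x; rewrite /null_space /= natmulfctE; last first.
  by case=> /range_projP -> // /range_projP -> //; rewrite mulr2n addrK subrr.
move=> h; have xE : x *+ 2 = P x + Q x.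
  by apply/eqP; rewrite -subr_eq0 opprD addrA h.
have PQ : P (Q x) = P x.
  by apply: (addrI (P x)); rewrite -{1}(projK P) // -linearD -xE linearMn mulr2n.
have QP : Q (P x) = Q x.
  by apply: (addIr (Q x)); rewrite -{1}(projK Q hQ x) -linearD -xE linearMn mulr2n.
have PxQx : P x = Q x.
  apply/eqP; rewrite -subr_eq0; apply/eqP; apply: (inner_eq0 (s := H)).
  have PPQ : inner (P x) (Q x) = inner (P x) (P x) :> A.
    by rewrite !(proj_adj P hP x) PQ projK.
  have QQP : inner (Q x) (P x) = inner (Q x) (Q x) :> A.
    by rewrite !(proj_adj Q hQ x) QP projK.
  by rewrite innerBl 2!innerBr PPQ QQP !subrr.
have Px : P x = x.
  apply: (scalerI (a := 2 : R[i])) => //.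
  by rewrite !scaler_nat xE -PxQx mulr2n.
by split; apply/range_projP; rewrite // -PxQx.
Qed.

End NullSpaces.

(** * The projection onto the closure of [R(Q P (1 - Q))] *)

Theorem corollary4p3 (R : realType) (A : cstarAlgType R) (H : hilbertModType A)
    (P Q : H -> H) (hP : is_projection P) (hQ : is_projection Q)
    (h1 : ortho_complemented (closure (range (idfun \- Q \+ P))))
    (h2 : ortho_complemented (closure (range (idfun *+ 2 \- P \- Q)))) :
  [/\ ortho_complemented (range Q `&` null_space P),
      ortho_complemented (range Q `&` range P),
      ortho_complemented (closure (range (Q \o P \o (idfun \- Q)))) &
      ortho_proj (closure (range (Q \o P \o (idfun \- Q)))) =
        Q \- ortho_proj (range Q `&` null_space P) \- ortho_proj (range Q `&` range P)].
Proof.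
have [P0 P0E] := is_projection_linear _ hP; have [Q0 Q0E] := is_projection_linear _ hQ.
move: P Q P0E Q0E hP hQ h1 h2 => _ _ -> ->; move: P0 Q0 => P Q hP hQ.
have aT1 : adjoint_of (idfun \- Q \+ P) (idfun \- Q \+ P).
  by move=> x y /=; rewrite innerDl innerDr innerBl innerBr (proj_adj P) // (proj_adj Q).
have aT2 : adjoint_of (idfun *+ 2 \- P \- Q) (idfun *+ 2 \- P \- Q).
  move=> x y; rewrite natmulfctE /= !mulr2n !(innerBl, innerDl, innerBr, innerDr).
  by rewrite (proj_adj P) // (proj_adj Q).
move=> /(ortho_complemented_null_space _ aT1); rewrite null_space_compl_add// => -[cE].
move=> + /(ortho_complemented_null_space _ aT2); rewrite null_space_compl_compl// => + [cF].
have [+ rE] := ortho_projP cE; have [+ rF] := ortho_projP cF.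
set N := range Q `&` null_space P in rE cE *; set M := range Q `&` range P in rF cF *.
move: (ortho_proj M) (ortho_proj N) rE rF => F0 E0 rE rF hF hE.
have [F FE] := is_projection_linear _ hF; have [E EE] := is_projection_linear _ hE.
move: F0 E0 FE EE rE rF hF hE => _ _ -> -> rE rF hF hE dE dF.
have aP := proj_adj P hP; have aQ := proj_adj Q hQ.
have aE := proj_adj E hE; have aF := proj_adj F hF.
have a0 : adjoint_of (fun=> 0 : H) (fun=> 0) by move=> x y; rewrite inner0l inner0r.
have [QE PE] : (forall x, Q (E x) = E x) /\ (forall x, P (E x) = 0).
  have NE x : N (E x) by rewrite -rE; exists x.
  by split=> x; have [/range_projP-/(_ hQ) QEx PEx] := NE x.
have [QF PF] : (forall x, Q (F x) = F x) /\ (forall x, P (F x) = F x).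
  have MF x : M (F x) by rewrite -rF; exists x.
  by split=> x; have [/range_projP-/(_ hQ) ? /range_projP-/(_ hP)] := MF x.
have EQ := adjoint_comp_swap _ _ _ aQ aE aE QE.
have EP := adjoint_comp_swap _ _ _ aP aE a0 PE.
have FQ := adjoint_comp_swap _ _ _ aQ aF aF QF.
have FP := adjoint_comp_swap _ _ _ aP aF aF PF.
have EF x : E (F x) = 0 by rewrite -PF EP.
have FE x : F (E x) = 0 by rewrite -FP PE linear0.
set C := closure _.
have C_range w : C (Q (P (w - Q w))) by apply: subset_closure; exists w.
have cC : closed C by exact: closed_closure.
pose G : {linear H -> H} := Q \- E \- F.
have GG x : G (G x) = G x.
  rewrite /G /= !(linearB Q, linearB E, linearB F) !projK// QE QF EQ EF FQ FE.
  by rewrite !subr0 !subrr !subr0.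
have hG : is_projection G.
  apply: is_projectionP => // x y.
  by rewrite /G /= !innerBl !innerBr aQ aE aF.
pose P' : {linear H -> H} := idfun \- P.
have hP' : is_projection P' := is_projection_compl P hP.
have CG x : C (G x).
  have -> : G x = (Q \- E) (x - F x).
    by rewrite /G /= linearB (linearB E) QF EF subr0 addrAC.
  have cQ := continuous_proj Q hQ; have cP' := continuous_proj P' hP'.
  have cE' := continuous_proj E hE.
  apply: closure_range_ind (dF x) => //.
    by move=> z; apply: continuousB; [exact: cQ|exact: cE'].
  (* Uses [E P = 0] and [E Q = E]. *)
  move=> w; have -> : (Q \- E) ((idfun *+ 2 \- P \- Q) w) = (Q \- E) (Q (P' w)).
    rewrite natmulfctE /P' /= mulr2n.
    rewrite !(linearB Q, linearB E, linearD Q, linearD E) !(projK Q hQ) EQ EP EQ EP.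
    by rewrite !subr0 addrK [_ - Q w]addrAC addrK.
  apply: (closure_range_ind _ _ _ _ _ _ _ (closure_range_compression P' Q w hP' hQ)) => //.
    by move=> z; apply: continuousB; [exact: cQ|exact: cE'].
  (* [E] times [Q P' Q] is [E] in either order, so [Q - E] moves to the right as [1 - E], where [dE]
     applies. *)
  move=> {}w; have -> : (Q \- E) ((Q \o P' \o Q) w) = (Q \o P' \o Q) (w - E w).
    rewrite /P' /= !(linearB Q, linearB E, linearB P) !(projK Q hQ).
    by rewrite !(QE, PE, EQ, EP) (linear0 Q) !subr0 addrAC.
  apply: closure_range_ind (dE w) => //.
    move=> z; apply: continuous_comp; first exact: cQ.
    by apply: continuous_comp; [exact: cP'|exact: cQ].
  move=> {}w; have -> : (Q \o P' \o Q) ((idfun \- Q \+ P) w) = (Q \o P') (Q (P w)).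
    rewrite -[LHS]/((Q \o P') (Q (w - Q w + P w))).
    by rewrite (linearD Q) (linearB Q) (projK Q hQ) subrr add0r.
  apply: (closure_range_ind _ _ _ _ _ _ _ (closure_range_compression P Q w hP hQ)) => //.
    by move=> z; apply: continuous_comp; [exact: cP'|exact: cQ].
  (* Both sides expand to [QPQw - QPQPQw]; the right one is the value of [Q P (1 - Q)] at [PQw]. *)
  move=> {}w; have -> : (Q \o P') ((Q \o P \o Q) w) = Q (P (P (Q w) - Q (P (Q w)))).
    by rewrite /P' /= !(linearB Q, linearB P) !(projK Q hQ) !(projK P hP).
  exact: C_range.
have onto : is_projection_onto C G.
  split=> //; apply/seteqP; split=> [_ [x _ <-]|]; first exact: CG.
  (* The range of [G] is closed, so it suffices that [G] fixes [R(Q P (1 - Q))], where [E] vanishes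
     by [E Q P = 0] and [F] by [F Q P = F = F Q]. *)
  rewrite /C closureE; apply: smallest_sub.
    rewrite range_projE//.
    by case: (closed_submodule_null_space _ _ (proj_adj _ (is_projection_compl G hG))).
  move=> _ [w _ <-]; apply/range_projP => //=.
  by rewrite (projK Q hQ) EQ EP FQ FP (linearB F) FQ subrr !subr0.
split=> //; [exact: ortho_complemented_proj onto|exact: ortho_proj_unique].
Qed.
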